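(* The graph property ''being a scorpion graph'' is not $\mathcal J_5$-hard on the vertex set $\omega$; i.e. Alice has a winning strategy in the game $\mathbb E_{\omega,S,\mathcal J_5}$, where $S$ is the property of being a scorpion graph.
   Context: A scorpion graph on a vertex set $V$ is a graph $\langle V,E\rangle$ with three special vertices, the sting $s$, the tail $t$ and the body $b$, such that the sting is adjacent only to the tail, the tail is adjacent only to the sting and the body, and the body is adjacent to all vertices except the sting (and itself). For $E\subseteq[\omega]^2$ let $\Omega(E)=\{v\in\omega:\text{$v$ has infinite degree in }\langle\omega,E\rangle\}$ and $\mathcal J_k=\{E\subseteq[\omega]^2:|\Omega(E)|\ge k\}$. Game $\mathbb E_{\omega,R,\mathcal F}$ (for a property $R$ and an upward closed $\mathcal F\subseteq\mathcal P([\omega]^2)$): a pregraph on $\omega$ is $\langle\omega,E,N\rangle$ with $E,N\subseteq[\omega]^2$ disjoint (edges, nonedges; $P=E\cup N$ determined pairs); a graph $\langle\omega,E'\rangle$ extends it if $E\subseteq E'$ and $E'\cap N=\emptyset$. Alice and Bob build a transfinite sequence of pregraphs starting with $\langle\omega,\emptyset,\emptyset\rangle$, taking unions at limits; at successor steps Alice picks an undetermined pair and Bob declares it edge or nonedge. The game terminates at the first stage $\beta$ at which either every graph extending the current pregraph $G_\beta$ has $R$ or none does. Bob wins iff the set $P_\beta$ of determined pairs at termination belongs to $\mathcal F$; otherwise Alice wins. $R$ is $\mathcal F$-hard on $\omega$ iff Alice has no winning strategy in this game. *)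

(* Defs.v *)
From mathcomp Require Import all_boot all_order finmap.
From mathcomp Require Import boolp classical_sets functions cardinality.

Set Implicit Arguments.
Unset Strict Implicit.
Unset Printing Implicit Defensive.

Local Open Scope classical_set_scope.
Local Open Scope card_scope.

(** The elements of [omega]^2. *)
Definition upair : Type := {e : {fset nat} | #|` e| == 2}.

(** A graph on omega is identified with its edge set. *)
Definition graph : Type := set upair.

Definition adj (E : graph) (v w : nat) : Prop :=
  exists2 e : upair, E e & val e = [fset v; w]%fset.

Definition scorpion (E : graph) : Prop :=
  exists s t b : nat,
    [/\ [/\ s <> t, t <> b & s <> b],
        forall v, adj E s v <-> v = t,
        forall v, adj E t v <-> v = s \/ v = b &
        forall v, adj E b v <-> v <> s /\ v <> b].

Definition infdeg (E : graph) : set nat :=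
  [set v | infinite_set [set w | adj E v w]].

Definition Jfam (k : nat) : set graph := [set E | `I_k #<= infdeg E].

Record pregraph : Type := Pregraph {
  edges : set upair;
  nonedges : set upair;
  edges_nonedges_disj : edges `&` nonedges = set0
}.

Definition determined (G : pregraph) : set upair := edges G `|` nonedges G.

Definition extends (X : graph) (G : pregraph) : Prop :=
  edges G `<=` X /\ X `&` nonedges G = set0.

Definition decided (R : set graph) (G : pregraph) : Prop :=
  (forall X, extends X G -> R X) \/ (forall X, extends X G -> ~ R X).

(** Alice asks for [e] at [G], and Bob's answer leads to [H]. *)
Definition move (G : pregraph) (e : upair) (H : pregraph) : Prop :=
  ~ determined G e /\
  ((edges H = e |` edges G /\ nonedges H = nonedges G) \/
   (edges H = edges G /\ nonedges H = e |` nonedges G)).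

Section Stages.
Context {d : Order.disp_t} {I : orderType d}.
Implicit Types i j : I.

Definition first_stage i : Prop := forall j, (i <= j)%O.
Definition last_stage i : Prop := forall j, (j <= i)%O.
Definition next_stage i j : Prop :=
  (i < j)%O /\ forall k, (i < k)%O -> (j <= k)%O.
Definition limit_stage j : Prop :=
  ~ first_stage j /\ forall i, ~ next_stage i j.

(** A (possibly unfinished) play: ordinals are represented by arbitrary
    well-ordered index types [I].  By [play_undecided] a play never continues
    past the first decided pregraph. *)
Record play (R : set graph) (G : I -> pregraph) : Prop := Play {
  play_wf : well_founded (fun i j => (i < j)%O);
  play_first : forall i, first_stage i ->
    edges (G i) = set0 /\ nonedges (G i) = set0;
  play_next : forall i j, next_stage i j -> exists e, move (G i) e (G j);
  play_limit : forall j, limit_stage j ->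
    edges (G j) = \bigcup_(i in [set i | (i < j)%O]) edges (G i) /\
    nonedges (G j) = \bigcup_(i in [set i | (i < j)%O]) nonedges (G i);
  play_undecided : forall i j, (i < j)%O -> ~ decided R (G i)
}.

(** The pregraphs of a play are strictly increasing, so the set of those
    occurring up to stage [i] carries exactly the information of the
    transfinite sequence of pregraphs up to stage [i]. *)
Definition history (G : I -> pregraph) i : set pregraph :=
  [set G j | j in [set j | (j <= i)%O]].

Definition follows (sigma : set pregraph -> upair) (G : I -> pregraph) : Prop :=
  forall i j, next_stage i j -> move (G i) (sigma (history G i)) (G j).

End Stages.

Definition alice_strategy (R : set graph) (sigma : set pregraph -> upair)
    : Prop :=
  forall (d : Order.disp_t) (I : orderType d) (G : I -> pregraph) (i : I),
    play R G -> last_stage i -> ~ decided R (G i) ->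
    ~ determined (G i) (sigma (history G i)).

Definition alice_wins (R F : set graph) (sigma : set pregraph -> upair)
    : Prop :=
  forall (d : Order.disp_t) (I : orderType d) (G : I -> pregraph) (b : I),
    play R G -> follows sigma G -> last_stage b -> decided R (G b) ->
    ~ F (determined (G b)).

Definition hard (R F : set graph) : Prop :=
  ~ exists sigma, alice_strategy R sigma /\ alice_wins R F sigma.

Lemma Jfam_upward_closed k (E E' : graph) :
  E `<=` E' -> Jfam k E -> Jfam k E'.
Proof.
move=> EE' /card_le_trans; apply; apply: subset_card_le => v /= vE.
by apply: sub_infinite_set vE => w [e Ee ew]; exists e => //; exact: EE'.
Qed.

(* Main.v *)
Require Import Defs.
From mathcomp Require Import all_boot.
From mathcomp Require Import all_order finmap zify.
From mathcomp Require Import boolp classical_sets cardinality.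

Set Implicit Arguments.
Unset Strict Implicit.
Unset Printing Implicit Defensive.

(** Call a vertex a possible sting (tail, body) of a pregraph if it is the sting
    (tail, body) of some scorpion graph extending it.

    Alice first asks all pairs of vertices at distance at most 4, so that every
    possible body gets three edges and is no longer a possible tail; an edge
    between a possible body and a possible sting then refutes that sting.  As
    long as there are two possible stings, she asks the least possible body
    about the two least ones: two nonedges would refute the body, so one of the
    three vertices drops out.  Once a single possible sting [s] is left she asks
    everything about [s], which reveals the tail [t], then everything about [t],
    which reveals the body [b], then everything about [b].

    While there are two possible stings and a possible body, only finitely many
    pairs have been asked at any vertex.  Hence at most one vertex is asked
    infinitely often in the role of the least possible body, and at most two in
    the role of a possible sting; the latter exhausts the possible bodies, so
    then the last phase never starts.  Otherwise the vertices of infinite degree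
    are among [s], [t], [b] and the one exceptional body. *)

Local Open Scope classical_set_scope.

(** * Pairs, least elements and small sets of naturals *)

Lemma fset2_eq (a b c d : nat) : [fset a; b]%fset = [fset c; d]%fset ->
  (a = c /\ b = d) \/ (a = d /\ b = c).
Proof.
move=> /fsetP h.
have := h a; have := h b; have := h c; have := h d.
by rewrite !inE !eqxx /= ?orbT; lia.
Qed.

Lemma adjC (E : graph) v w : adj E v w -> adj E w v.
Proof. by move=> [e Ee ve]; exists e => //; rewrite ve fsetUC. Qed.

Lemma nat_least (P : nat -> Prop) : (exists n, P n) ->
  exists2 n, P n & forall m, P m -> n <= m.
Proof.
move=> exP; have exP' : exists n, `[<P n>].
  by case: exP => n Pn; exists n; apply/asboolP.
case: (ex_minnP exP') => n /asboolP Pn nmin.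
by exists n => // m Pm; apply: nmin; apply/asboolP.
Qed.

Lemma bounded_finite (P : set nat) n :
  (forall w, P w -> w <= n) -> finite_set P.
Proof. by move=> h; apply: (sub_finite_set _ (finite_II n.+1)) => w /h. Qed.

Lemma not_Jfam_seq (E : graph) (l : seq nat) k : size l < k ->
  (forall v, infdeg E v -> v \in l) -> ~ Jfam k E.
Proof.
move=> lk sub JE.
pose F : {fset nat} := [fset x in l]%fset.
have sF : infdeg E `<=` [set` F] by move=> v /sub vl; rewrite /= inE.
have := leq_card_fset_set (finite_fset F)
  (card_le_trans JE (subset_card_le sF)).
rewrite set_fsetK card_fseq => /(leq_trans lk).
by rewrite ltnNge size_undup.
Qed.

Lemma at_most_one (P : set nat) : (forall x y, P x -> P y -> x = y) ->
  exists a, forall x, P x -> x = a.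
Proof.
move=> uP; case: (pselect (exists a, P a)) => [[a Pa]|nP].
  by exists a => x Px; exact: uP.
by exists 0 => x Px; case: nP; exists x.
Qed.

Lemma at_most_two (P : set nat) :
  (forall x y z, P x -> P y -> P z -> x < y -> y < z -> False) ->
  exists a b, forall x, P x -> x = a \/ x = b.
Proof.
move=> tP; case: (pselect (exists a, P a)) => [/nat_least[a Pa amin]|nP];
  last first.
  by exists 0, 0 => x Px; case: nP; exists x.
have [b ub] : exists b, forall x, P x /\ x <> a -> x = b.
  apply: at_most_one => x y [Px nx] [Py ny].
  have := amin _ Px; have := amin _ Py => ay ax.
  have [xy|yx|//] := ltngtP x y; exfalso.
  - by apply: (tP a x y) => //; lia.
  - by apply: (tP a y x) => //; lia.
exists a, b => x Px; case: (pselect (x = a)) => [|nx]; first by left.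
by right; exact: ub.
Qed.

(** * Possible stings, tails and bodies of a pregraph *)

Section Candidates.
Implicit Types (G H : pregraph) (X Y : graph).

Definition subpregraph G H : Prop :=
  edges G `<=` edges H /\ nonedges G `<=` nonedges H.

Definition scorpion_at (E : graph) (s t b : nat) : Prop :=
  [/\ [/\ s <> t, t <> b & s <> b],
      forall v, adj E s v <-> v = t,
      forall v, adj E t v <-> v = s \/ v = b &
      forall v, adj E b v <-> v <> s /\ v <> b].

Definition possible G (s t b : nat) : Prop :=
  exists2 X, extends X G & scorpion_at X s t b.

Definition stings G : set nat := [set s | exists t b, possible G s t b].
Definition tails G : set nat := [set t | exists s b, possible G s t b].
Definition bodies G : set nat := [set b | exists s t, possible G s t b].

Lemma subpregraph_refl G : subpregraph G G.
Proof. by split. Qed.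

Lemma subpregraph_trans H G K :
  subpregraph G H -> subpregraph H K -> subpregraph G K.
Proof.
move=> [e1 n1] [e2 n2].
by split; [exact: subset_trans e2|exact: subset_trans n2].
Qed.

Lemma subpregraph_anti G H : subpregraph G H -> subpregraph H G -> G = H.
Proof.
case: G H => [E N d] [E' N' d'] [/= e1 n1] [/= e2 n2].
have eE : E = E' by apply/seteqP.
have eN : N = N' by apply/seteqP.
by subst; congr Pregraph; exact: Prop_irrelevance.
Qed.

Lemma extends_sub X G H : subpregraph G H -> extends X H -> extends X G.
Proof.
move=> [eGH nGH] [eX nX]; split; first exact: subset_trans eX.
by apply/seteqP; split => // e [Xe /nGH ne]; rewrite -nX.
Qed.

Lemma possible_sub G H s t b :
  subpregraph G H -> possible H s t b -> possible G s t b.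
Proof. by move=> GH [X XH sX]; exists X => //; exact: extends_sub XH. Qed.

Lemma stings_sub G H : subpregraph G H -> stings H `<=` stings G.
Proof. by move=> GH x [t [b p]]; exists t, b; exact: possible_sub p. Qed.

Lemma tails_sub G H : subpregraph G H -> tails H `<=` tails G.
Proof. by move=> GH x [t [b p]]; exists t, b; exact: possible_sub p. Qed.

Lemma bodies_sub G H : subpregraph G H -> bodies H `<=` bodies G.
Proof. by move=> GH x [t [b p]]; exists t, b; exact: possible_sub p. Qed.

Lemma undecided_possible G :
  ~ decided scorpion G -> exists s t b, possible G s t b.
Proof.
move=> ndec; apply: contrapT => np; apply: ndec; right => X XG [s [t [b sX]]].
by apply: np; exists s, t, b, X.
Qed.

Lemma undecided_stings G : ~ decided scorpion G -> stings G !=set0.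
Proof. by move=> /undecided_possible[s [t [b p]]]; exists s, t, b. Qed.

Lemma undecided_tails G : ~ decided scorpion G -> tails G !=set0.
Proof. by move=> /undecided_possible[s [t [b p]]]; exists t, s, b. Qed.

Lemma undecided_bodies G : ~ decided scorpion G -> bodies G !=set0.
Proof. by move=> /undecided_possible[s [t [b p]]]; exists b, s, t. Qed.

(** Vacuous for [v = w], no [upair] being a singleton, so all pairs at [v] are settled iff this
    holds for every [w]. *)
Definition settled G (v w : nat) : Prop :=
  forall e : upair, val e = [fset v; w]%fset -> determined G e.

Lemma settled_adj G X Y v w : extends X G -> extends Y G -> settled G v w ->
  adj X v w -> adj Y v w.
Proof.
move=> [_ nX] [eY _] st [e Xe ve]; exists e => //.
case: (st e ve) => [/eY //|ne].
by have : (X `&` nonedges G) e by []; rewrite nX.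
Qed.

(** * The pairs Alice asks *)

Definition near (v w : nat) : Prop := v < w + 5 /\ w < v + 5.

(** Four pairs at [b] are settled, at least three of them as edges, so [b]
    can be neither the sting nor the tail of a scorpion graph extending [G]. *)
Lemma settled_body_sting G X s' t' b s :
  (forall v w, near v w -> settled G v w) ->
  extends X G -> scorpion_at X s' t' b -> stings G s -> settled G b s -> s = s'.
Proof.
move=> nearG XG [_ _ _ bX] [t2 [b2 [Y YG [_ sY tY _]]]] bs.
have nb i : 0 < i < 5 -> b + i = s' \/ adj Y b (b + i).
  move=> i5; case: (pselect (b + i = s')) => [|ns]; first by left.
  right; apply: (settled_adj XG YG); first by apply: nearG; split; lia.
  by apply/bX; split => //; lia.
apply: contrapT => ns.
have {ns}[sb|bY] : s = b \/ adj Y b s.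
  case: (pselect (s = b)) => [|nsb]; first by left.
  by right; apply: (settled_adj XG YG bs); apply/bX.
- subst s; have {}nb i : 0 < i < 5 -> b + i = s' \/ b + i = t2.
    by move=> /nb[|/sY]; [left|right].
  by have := nb 1 isT; have := nb 2 isT; have := nb 3 isT; lia.
(* Now [b] is the tail in [Y], so [s'] and the two neighbours [s], [b2] must cover all of [b + i].
   Three vertices cannot cover four, which is why [near] reaches distance 4. *)
- have /sY bt := adjC bY; subst t2.
  have {}nb i : 0 < i < 5 -> [\/ b + i = s', b + i = s | b + i = b2].
    by move=> /nb[->|/tY[->|->]]; [constructor 1|constructor 2|constructor 3].
  have := nb 1 isT; have := nb 2 isT; have := nb 3 isT; have := nb 4 isT.
  by move=> [] h1 [] h2 [] h3 [] h4; lia.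
Qed.

Definition body_query G (b s : nat) : Prop :=
  [/\ bodies G b, forall x, bodies G x -> b <= x &
   exists s0 s1, [/\ stings G s0, stings G s1, s0 < s1,
     forall x, stings G x -> x = s0 \/ s1 <= x & s = s0 \/ s = s1]].

Definition last_query G (x : nat) : Prop :=
  (exists s, stings G = [set s]) /\
  [\/ stings G = [set x], tails G = [set x] | bodies G = [set x]].

Definition good_query G (e : upair) : Prop :=
  ~ determined G e /\
  [\/ exists v w, near v w /\ val e = [fset v; w]%fset,
      exists b s, body_query G b s /\ val e = [fset b; s]%fset |
      exists x, last_query G x /\ x \in val e].

(** If no good query is left, sting, tail and body are forced in turn to be those of one scorpion
    extension [X]. Every extension then agrees with [X] at these three vertices, hence is a scorpion
    graph, and [G] is decided. *)
Lemma good_query_ex G : ~ decided scorpion G -> exists e, good_query G e.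
Proof.
move=> ndec; apply: contrapT => nge.
have nearG v w : near v w -> settled G v w.
  move=> vw e ve; apply: contrapT => ne; apply: nge; exists e; split => //.
  by constructor 1; exists v, w.
have queryG b s : body_query G b s -> settled G b s.
  move=> q e ve; apply: contrapT => ne; apply: nge; exists e; split => //.
  by constructor 2; exists b, s.
have lastG x y : last_query G x -> settled G x y.
  move=> q e ve; apply: contrapT => ne; apply: nge; exists e; split => //.
  by constructor 3; exists x; split => //; rewrite ve !inE eqxx.
have [b [s' [t' [X XG sX]]] bmin] := nat_least (undecided_bodies ndec).
have bB : bodies G b by exists s', t', X.
have [s0 s0S s0min] := nat_least (undecided_stings ndec).
have stingG : stings G = [set s0].
  apply/seteqP; split=> [x xS|x ->//]; apply: contrapT => /= nx.
  have [|s1 [s1S ns1] s1min] := @nat_least (fun x => stings G x /\ x <> s0).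
    by exists x.
  have s01 : s0 < s1 by have := s0min _ s1S; lia.
  have q s : s = s0 \/ s = s1 -> body_query G b s.
    move=> ss; split => //; exists s0, s1; split => // y yS.
    by case: (pselect (y = s0)) => [|ny]; [left|right; exact: s1min].
  (* The two least possible stings would both equal the sting [s'] of [X]. *)
  have e0 := settled_body_sting nearG XG sX s0S
    (queryG _ _ (q _ (or_introl erefl))).
  have e1 := settled_body_sting nearG XG sX s1S
    (queryG _ _ (q _ (or_intror erefl))).
  by lia.
have oneS : exists s, stings G = [set s] by exists s0.
have sting_eq s t c : possible G s t c -> s = s0.
  move=> p; have sS : stings G s by exists t, c.
  by rewrite stingG in sS.
have es' : s' = s0 by apply: (@sting_eq _ t' b); exists X.
subst s'.
have [[st tb sb] sX' tX bX] := sX.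
have s0G y : settled G s0 y by apply: lastG; split => //; constructor 1.
have tail_eq s t c : possible G s t c -> t = t'.
  move=> p; have es := sting_eq _ _ _ p; subst s.
  case: p => Y YG [_ sY _ _]; apply/sX'.
  by apply: (settled_adj YG XG) => //; apply/sY.
have tG y : settled G t' y.
  apply: lastG; split => //; constructor 2; apply/seteqP; split.
    by move=> x [s [c p]]; exact: tail_eq p.
  by move=> x ->; exists s0, b, X.
have body_eq s t c : possible G s t c -> c = b.
  move=> p; have es := sting_eq _ _ _ p; have et := tail_eq _ _ _ p; subst s t.
  case: p => Y YG [[_ _ nsc] _ tY _].
  have /tX[//|//] : adj X t' c.
    by apply: (settled_adj YG XG) => //; apply/tY; right.
  by move=> ?; subst c.
have bG y : settled G b y.
  apply: lastG; split => //; constructor 3; apply/seteqP; split.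
    by move=> x [s [c p]]; exact: body_eq p.
  by move=> x ->.
apply: ndec; left => Y YG; exists s0, t', b; split => // v.
- by split=> [h|h]; [apply/sX'; exact: settled_adj YG XG _ h|
    apply: (settled_adj XG YG (s0G _)); exact/sX'].
- by split=> [h|h]; [apply/tX; exact: settled_adj YG XG _ h|
    apply: (settled_adj XG YG (tG _)); exact/tX].
- by split=> [h|h]; [apply/bX; exact: settled_adj YG XG _ h|
    apply: (settled_adj XG YG (bG _)); exact/bX].
Qed.

End Candidates.

(** * Queries along a chain of undecided pregraphs *)

Section Chain.
Variable K : set pregraph.
Hypothesis K_total :
  forall G H, K G -> K H -> subpregraph G H \/ subpregraph H G.
Hypothesis K_undecided : forall G, K G -> ~ decided scorpion G.

Lemma chain_singleton (A : pregraph -> set nat) :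
  (forall G H, subpregraph G H -> A H `<=` A G) ->
  (forall G, K G -> A G !=set0) ->
  exists a, forall x, (exists2 G, K G & A G = [set x]) -> x = a.
Proof.
move=> subA nA; apply: at_most_one => x y [G KG Ax] [H KH Ay].
have [/subA|/subA] := K_total KG KH; rewrite Ax Ay.
- by move=> /(_ y erefl).
- by move=> /(_ x erefl).
Qed.

Definition asked (b s : nat) : Prop := exists2 G, K G & body_query G b s.

(** Stings possible at [G] were possible earlier, so the second least of them bounds the two least
    at every earlier pregraph. *)
Lemma asked_sting_bounded G b0 s0 : body_query G b0 s0 ->
  exists m, forall H b s, subpregraph H G -> body_query H b s -> s <= m.
Proof.
move=> [_ _ [x [y [xS yS xy _ _]]]]; exists y => H b s HG.
move=> [_ _ [x' [y' [_ _ xy' min' ss]]]].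
have := min' _ (stings_sub HG xS); have := min' _ (stings_sub HG yS).
by case: ss => ->; lia.
Qed.

(** The least possible body never decreases. So if [v < v'], all queries with body [v] precede one
    with body [v'], and that one bounds their stings. *)
Lemma infinite_body_unique :
  exists a, forall v, infinite_set [set w | asked v w] -> v = a.
Proof.
apply: at_most_one => v v' iv iv'.
wlog vv' : v v' iv iv' / v < v'.
  by move=> hw; have [/hw->//|/hw->//|//] := ltngtP v v'.
exfalso; apply: iv.
have [w' [G KG q]] := infinite_setN0 iv'.
have [m hm] := asked_sting_bounded q.
apply: (@bounded_finite _ m) => w [H KH qH].
have [GH|HG] := K_total KG KH; last exact: hm HG qH.
case: q qH => [_ bmin _] [bH _ _].
by have := bmin _ (bodies_sub GH bH); lia.
Qed.

(** Otherwise [v] is asked as a sting only before [G], when the least possible body is at most any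
    body possible at [G]. *)
Lemma infinite_sting_alive G v : K G -> infinite_set [set w | asked w v] ->
  stings G v /\ exists x, stings G x /\ x <> v.
Proof.
move=> KG iv; apply: contrapT => nS; apply: iv.
have [c cB] := undecided_bodies (K_undecided KG).
apply: (@bounded_finite _ c) => b [H KH [bH bmin [x [y [xS yS xy _ vxy]]]]].
have [GH|HG] := K_total KG KH; last exact: bmin (bodies_sub HG cB).
exfalso; apply: nS; have sub := stings_sub GH.
by case: vxy => ->; split; [exact: sub|exists y; split; [exact: sub|lia]|
  exact: sub|exists x; split; [exact: sub|lia]].
Qed.

Lemma infinite_stings_two :
  exists a b, forall v, infinite_set [set w | asked w v] -> v = a \/ v = b.
Proof.
apply: at_most_two => x y z ix iy iz xy yz.
(* When the largest, [z], is asked, [x] and [y] are still possible, so [z] is not among the two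
   least. *)
have [b [G KG [_ _ [s0 [s1 [_ _ s01 smin zs]]]]]] := infinite_setN0 iz.
have [/smin xS _] := infinite_sting_alive KG ix.
have [/smin yS _] := infinite_sting_alive KG iy.
by case: zs => zs; lia.
Qed.

Lemma good_chain_not_Jfam5 (D : graph) :
  (forall e, D e -> exists2 G, K G & good_query G e) -> ~ Jfam 5 D.
Proof.
move=> goodD.
have [s us] := chain_singleton stings_sub
  (fun G KG => undecided_stings (K_undecided KG)).
have [t ut] := chain_singleton tails_sub
  (fun G KG => undecided_tails (K_undecided KG)).
have [b ub] := chain_singleton bodies_sub
  (fun G KG => undecided_bodies (K_undecided KG)).
have [c uc] := infinite_body_unique.
have [a [a' ua]] := infinite_stings_two.
have lastE x : (exists2 G, K G & last_query G x) -> x \in [:: s; t; b].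
  move=> [G KG [_ [h|h|h]]]; rewrite !inE.
  - by rewrite (us x) ?eqxx //; exists G.
  - by rewrite (ut x) ?eqxx ?orbT //; exists G.
  - by rewrite (ub x) ?eqxx ?orbT //; exists G.
have infE v : infdeg D v -> [\/ exists2 G, K G & last_query G v,
    infinite_set [set w | asked v w] | infinite_set [set w | asked w v]].
  move=> iv; apply: contrapT => nv; apply: iv.
  have fb : finite_set [set w | asked v w].
    by apply: contrapT => i; apply: nv; constructor 2.
  have fs : finite_set [set w | asked w v].
    by apply: contrapT => i; apply: nv; constructor 3.
  have fn : finite_set [set w | w <= v + 5].
    by exact: (@bounded_finite _ (v + 5)).
  have fl : finite_set [set w | w \in [:: s; t; b]] by exact: finite_seq.
  (* Besides the two roles in body queries, a pair at [v] is near or a last query made for its other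
     end, which lies in [[:: s; t; b]]. *)
  apply: (@sub_finite_set _ _ (([set w | asked v w] `|` [set w | asked w v])
    `|` ([set w | w <= v + 5] `|` [set w | w \in [:: s; t; b]]))); last first.
    by rewrite !finite_setU.
  move=> w /= [e De ve]; have [G KG [_ ge]] := goodD _ De.
  case: ge => [[x [y [xy]]]|[x [y [q]]]|[x [q]]]; rewrite ve.
  - by move=> /fset2_eq[[-> ->]|[-> ->]]; right; left; case: xy; lia.
  - by move=> /fset2_eq[[-> ->]|[-> ->]]; left; [left|right]; exists G.
  - rewrite !inE => /orP[/eqP xv|/eqP xw].
      by case: nv; constructor 1; exists G; rewrite -?xv.
    right; right; rewrite -xw.
    by have := lastE x (ex_intro2 _ _ G KG q); rewrite !inE.
(* A stage with a single possible sting excludes infinitely asked stings; without one there are no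
   last queries. *)
case: (pselect (exists2 G, K G & exists x, stings G = [set x]))
    => [[G KG [x Gx]]|nl].
- apply: (@not_Jfam_seq _ [:: s; t; b; c]) => // v /infE[/lastE|/uc->|iv].
  + by rewrite !inE => /or3P[] ->; rewrite ?orbT.
  + by rewrite !inE eqxx ?orbT.
  + have [] := infinite_sting_alive KG iv; rewrite Gx => -> [y [->]].
    by case.
- apply: (@not_Jfam_seq _ [:: c; a; a']) => // v.
  move=> /infE[[G KG [h _]]|/uc->|/ua[]->].
  + by case: nl; exists G.
  + by rewrite !inE eqxx ?orbT.
  + by rewrite !inE eqxx ?orbT.
  + by rewrite !inE eqxx ?orbT.
Qed.

End Chain.

(** * Monotonicity of plays and the origin of determined pairs *)

Section Plays.
Context {d : Order.disp_t} {I : orderType d}.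
Variables (R : set graph) (G : I -> pregraph).
Hypothesis playG : play R G.

Lemma stage_cases (j : I) :
  [\/ first_stage j, limit_stage j | exists i, next_stage i j].
Proof.
case: (pselect (first_stage j)) => [|nf]; first by constructor 1.
case: (pselect (exists i, next_stage i j)) => [|nn]; first by constructor 3.
by constructor 2; split => // i ni; apply: nn; exists i.
Qed.

Lemma move_sub (A : pregraph) e B : move A e B -> subpregraph A B.
Proof.
by move=> [_ [[eB nB]|[eB nB]]]; split; rewrite ?eB ?nB // => x; right.
Qed.

Lemma move_determined (A : pregraph) e B x : move A e B ->
  determined B x -> determined A x \/ x = e.
Proof.
rewrite /determined; move=> [_ [[-> ->]|[-> ->]]].
- by case=> [[->|xA]|xA]; [right|left; left|left; right].
- by case=> [xA|[->|xA]]; [left; left|right|left; right].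
Qed.

Lemma next_stage_le (i k j : I) : next_stage k j -> (i < j)%O -> (i <= k)%O.
Proof.
move=> [kj kmin] ij; rewrite Order.TotalTheory.leNgt; apply/negP => /kmin.
by rewrite Order.TotalTheory.leNgt ij.
Qed.

Lemma play_sub (i j : I) : (i <= j)%O -> subpregraph (G i) (G j).
Proof.
elim/(well_founded_ind (play_wf playG)): j i => j IH i.
rewrite Order.POrderTheory.le_eqVlt => /orP[/eqP->|ij].
  exact: subpregraph_refl.
case: (stage_cases j) => [fj|lj|[k kj]].
- by have := fj i; rewrite Order.TotalTheory.leNgt ij.
- have [ej nj] := play_limit playG lj.
  by split; rewrite ?ej ?nj => x xi; exists i.
- have [e /move_sub] := play_next playG kj.
  by apply: subpregraph_trans; apply: IH; [case: kj|exact: next_stage_le ij].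
Qed.

Lemma play_determined sigma (j : I) e : follows sigma G -> determined (G j) e ->
  exists i k, next_stage i k /\ e = sigma (history G i).
Proof.
move=> fG; elim/(well_founded_ind (play_wf playG)): j => j IH.
case: (stage_cases j) => [fj|lj|[k kj]].
- by have [ej nj] := play_first playG fj; rewrite /determined ej nj => -[].
- have [ej nj] := play_limit playG lj; rewrite /determined ej nj.
  by case=> [[i ij ei]|[i ij ei]]; apply: (IH i ij); [left|right].
- move=> /(move_determined (fG _ _ kj))[|->]; last by exists k, j.
  by apply: IH; case: kj.
Qed.

End Plays.

Theorem theorem4p7 : ~ hard scorpion (Jfam 5).
Proof.
(* A strategy sees only the set of past pregraphs; the current one is recovered as its greatest
   element. *)
pose answers (H : set pregraph) e := forall G, H G ->
  (forall G', H G' -> subpregraph G' G) -> ~ decided scorpion G ->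
  good_query G e.
have [sigma sigmaP] : {sigma & forall H, answers H (sigma H)}.
  apply: choice => H; rewrite /answers.
  case: (pselect (exists G, [/\ H G, forall G', H G' -> subpregraph G' G &
      ~ decided scorpion G])) => [[G [HG Gmax ndec]]|nG].
    have [e ge] := good_query_ex ndec; exists e => G' HG' G'max _.
    by rewrite (subpregraph_anti (Gmax _ HG') (G'max _ HG)).
  (* An arbitrary default pair for sets that are not histories of an undecided position. *)
  have c2 : #|` [fset 0; 1]%fset| == 2 by rewrite cardfs2.
  exists (exist (fun e : {fset nat} => #|` e| == 2) [fset 0; 1]%fset c2).
  by move=> G HG Gmax ndec; case: nG; exists G.
have good d (I : orderType d) (G : I -> pregraph) i : play scorpion G ->
    ~ decided scorpion (G i) -> good_query (G i) (sigma (history G i)).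
  move=> pG; apply: (sigmaP (history G i)); first by exists i => //=.
  by move=> _ [j /= ji <-]; exact: (play_sub pG).
apply; exists sigma; split => [d I G i pG _ ndec|d I G b pG fG _ _].
  by have [] := good _ _ _ _ pG ndec.
(* Only stages with a successor enter the chain: Alice moved there, and the decided final stage is
   left out. *)
apply: (@good_chain_not_Jfam5 [set H | exists i k, next_stage i k /\ H = G i]).
- move=> _ _ [i [_ [_ ->]]] [j [_ [_ ->]]].
  have /orP[ij|ji] := Order.TotalTheory.le_total i j.
    by left; exact: (play_sub pG).
  by right; exact: (play_sub pG).
- by move=> _ [i [k [[ik _] ->]]]; exact: (play_undecided pG ik).
- move=> e /(play_determined pG fG)[i [k [ik ->]]].
  exists (G i); first by exists i, k.
  by apply: good => //; case: ik => ik _; exact: (play_undecided pG ik).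
Qed.
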